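(* Let $I\subset\mathbf k[\mathbf x]$ be a monomial ideal with cofinite support and $x_j\notin I$ for all $j$, and let $2e_i$ be a root. Then $2e_i$ is reducible if and only if one of the following holds: (i) $3e_i\in\operatorname{supp}(I)$; (ii) there is $k\ne i$ such that $2e_i-e_k$ is a root and $e_i+e_k\notin\operatorname{supp}(I)$; (iii) there is $k\ne i$ such that $e_k-e_i$ and $3e_i-e_k$ are roots. Moreover, if $2e_i$ is irreducible (i.e. if none of these conditions holds), then $e_i\in E_{2e_i}$ and $B_{2e_i}=\langle\overline\partial_{2e_i,e_j^*} : e_j\in E_{2e_i},\ j\ne i\rangle$, which is a hyperplane of $\mathfrak g_{2e_i}$; hence $\mu(2e_i)=1$.
   Context: Setting: $\mathbf k$ is an algebraically closed field of characteristic zero, $n\ge1$, $M=\mathbb Z^n$ with canonical basis $E=\{e_1,\dots,e_n\}$, and $N_{\mathbf k}=\operatorname{Hom}(M,\mathbf k)\cong\mathbf k^n$ with dual basis $e_1^*,\dots,e_n^*$. $\mathbf k[\mathbf x]=\mathbf k[x_1,\dots,x_n]$ and $\mathbf x^m=x_1^{m_1}\cdots x_n^{m_n}$. For a monomial ideal $I$, $\operatorname{supp}(I)=\{m\in\mathbb Z^n_{\ge0}:\mathbf x^m\in I\}$; $I$ has cofinite support if $\mathbb Z^n_{\ge0}\setminus\operatorname{supp}(I)$ is finite. Set $A=\mathbf k[\mathbf x]/I$. For $\alpha\in\mathbb Z^n$ and $p\in N_{\mathbf k}$, $\partial_{\alpha,p}$ denotes the homogeneous derivation $\mathbf x^m\mapsto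 p(m)\mathbf x^{m+\alpha}$ of $\mathbf k[\mathbf x]$ (whenever it maps $\mathbf k[\mathbf x]$ to itself), and $\overline\partial_{\alpha,p}$ the derivation induced on $A$ when $\partial_{\alpha,p}(I)\subseteq I$. A degree $\alpha$ is inner if $\alpha\in\mathbb Z_{\ge0}^n$ and outer otherwise. Put $E_\alpha=\{e_i\in E : \alpha+e_i\in\mathbb Z^n_{\ge0}\setminus\operatorname{supp}(I)\}$. A root is a degree $\alpha\ne0$ for which there is a nonzero homogeneous derivation of $A$ of degree $\alpha$; $\mathcal R(I)$ is the set of roots. Explicitly, an inner $\alpha\neq 0$ is a root iff $E_\alpha\neq\varnothing$; an outer $\alpha$ is a root iff it has exactly one negative coordinate, say $\alpha_k=-1$, for every $\beta\in\operatorname{supp}(I)$ either $\alpha+\beta\in\operatorname{supp}(I)$ or $\alpha+\beta\notin\mathbb Z^n_{\ge0}$, and $E_\alpha\ne\varnothing$ (then $E_\alpha=\{e_k\}$). $N(\alpha)=\bigoplus_{e_i\in E_\alpha}\mathbf k e_i^*$ for inner roots, $N(\alpha)=\mathbf k e_k^*$ for outer roots with $\alpha_k=-1$. Put $\mathfrak g_\alpha=\{\overline\partial_{\alpha,p}:p\in N(\alpha)\}\subset\operatorname{Der}_{\mathbf k}(A)$. For a root $\gamma$, $B_\gamma=\sum[\mathfrak g_\alpha,\mathfrak g_\beta]\subseteq\mathfrak g_\gamma$, sum over $\alpha,\beta\in\mathcal R(I)$ with $\alpha+\beta=\gamma$, and $\mu(\gamma)=\dim_{\mathbf k}(\mathfrak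 g_\gamma/B_\gamma)$. $\gamma$ is reducible if $B_\gamma=\mathfrak g_\gamma$ and irreducible otherwise. *)

(* Defs.v *)
From HB Require Import structures.
From mathcomp Require Import all_boot all_order all_algebra.
From mathcomp Require Import boolp classical_sets functions.
From mathcomp Require Import mpoly.

Set Implicit Arguments.
Unset Strict Implicit.
Unset Printing Implicit Defensive.

Import Order.TTheory GRing.Theory Num.Theory.
Local Open Scope ring_scope.
Local Open Scope classical_set_scope.
Local Open Scope quotient_scope.

Section LinearAlgebra.
Context {K : fieldType} {U : lmodType K}.
Implicit Types X V W : set U.

Definition lspan X : set U :=
  [set u | exists (r : nat) (c : 'I_r -> K) (v : 'I_r -> U),
      (forall j, X (v j)) /\ u = \sum_j c j *: v j].

Definition subspace W : Prop :=
  W 0 /\ forall (c : K) (u v : U), W u -> W v -> W (c *: u + v).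

(* For subspaces W of V: some d vectors of V form a basis of V modulo W. *)
Definition is_dim_quot V W (d : nat) : Prop :=
  exists v : 'I_d -> U, (forall j, V (v j)) /\
    forall u, V u -> exists! c : 'rV[K]_d, W (u - \sum_j c ord0 j *: v j).

(* The value is 0 by default when V / W is infinite-dimensional. *)
Definition dim_quot V W : nat := xget 0%N [set d | is_dim_quot V W d].

Definition hyperplane V W : Prop :=
  [/\ subspace W, W `<=` V & is_dim_quot V W 1].

End LinearAlgebra.

(* The K-vector space structure of the quotient of K[x_1, ..., x_n] by I. *)
Section QuotientLmodule.
Variables (K : fieldType) (n : nat) (I : idealr {mpoly K[n]}).
Local Notation A := {ideal_quot I}.

Definition quot_scale (c : K) (a : A) : A := \pi_A (c%:MP) * a.

Fact quot_scaleA c d a : quot_scale c (quot_scale d a) = quot_scale (c * d) a.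
Proof. by rewrite /quot_scale mulrA -rmorphM /= mpolyCM. Qed.

Fact quot_scale1 : left_id 1 quot_scale.
Proof. by move=> a; rewrite /quot_scale mpolyC1 rmorph1 mul1r. Qed.

Fact quot_scaleDr : right_distributive quot_scale +%R.
Proof. by move=> c a b; rewrite /quot_scale mulrDr. Qed.

Fact quot_scaleDl a : {morph quot_scale^~ a : c d / c + d}.
Proof. by move=> c d; rewrite /quot_scale mpolyCD rmorphD mulrDl. Qed.

HB.instance Definition _ := GRing.Zmodule_isLmodule.Build K A
  quot_scaleA quot_scale1 quot_scaleDr quot_scaleDl.

Lemma quot_piZ (c : K) (f : {mpoly K[n]}) : \pi_A (c *: f) = c *: \pi_A f.
Proof. by rewrite -mul_mpolyC rmorphM. Qed.

End QuotientLmodule.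

(* M = Z^n is 'rV[int]_n; N_K = Hom(M, K) is identified with 'rV[K]_n through
   the dual basis. *)
Section Degrees.
Variables (K : fieldType) (n : nat).

Definition ev (i : 'I_n) : 'rV[int]_n := delta_mx ord0 i.

Definition ev_dual (i : 'I_n) : 'rV[K]_n := delta_mx ord0 i.

Definition pairing (p : 'rV[K]_n) (m : 'rV[int]_n) : K :=
  \sum_i p ord0 i * (m ord0 i)%:~R.

Definition inner (m : 'rV[int]_n) : bool := [forall i, 0 <= m ord0 i].

Definition mnm_of (m : 'rV[int]_n) : 'X_{1..n} :=
  [multinom `|m ord0 i|%N | i < n].

Definition of_mnm (m : 'X_{1..n}) : 'rV[int]_n := \row_i (m i)%:Z.

(* x^m if m is in Z_{>=0}^n, and 0 otherwise. *)
Definition xmon (m : 'rV[int]_n) : {mpoly K[n]} :=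
  if inner m then 'X_[mnm_of m] else 0.

(* The linear map x^m |-> p(m) x^(m + alpha).  The terms whose exponent has a
   negative coordinate are dropped by xmon; they all have p(m) = 0 exactly when
   partial_{alpha, p} maps K[x] to itself, so nothing is dropped in that case. *)
Definition der (alpha : 'rV[int]_n) (p : 'rV[K]_n) (f : {mpoly K[n]}) :
    {mpoly K[n]} :=
  \sum_(m <- msupp f)
    (f@_m * pairing p (of_mnm m)) *: xmon (of_mnm m + alpha).

End Degrees.

Arguments ev {n} i.
Arguments ev_dual {K n} i.
Arguments xmon {K n} m.

Section MonomialIdeals.
Variables (K : fieldType) (n : nat) (I : idealr {mpoly K[n]}).
Local Notation A := {ideal_quot I}.
Implicit Types (alpha gamma m : 'rV[int]_n) (D : A -> A).

Definition monomial_ideal : Prop :=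
  exists G : set 'X_{1..n}, forall f : {mpoly K[n]}, f \in I <->
    exists (r : nat) (q : 'I_r -> {mpoly K[n]}) (m : 'I_r -> 'X_{1..n}),
      (forall j, G (m j)) /\ f = \sum_j q j * 'X_[m j].

Definition supp : {pred 'rV[int]_n} :=
  [pred m | inner m && ('X_[mnm_of m] \in I)].

Definition cofinite_support : Prop :=
  exists s : seq 'rV[int]_n, forall m, inner m -> m \notin supp -> m \in s.

Definition derivation D : Prop :=
  linear D /\ forall a b, D (a * b) = D a * b + a * D b.

(* The component of degree m of the Z^n-graded algebra A. *)
Definition component m : set A :=
  [set a | exists c : K, a = c *: \pi_A (xmon m)].

Definition homogeneous D alpha : Prop :=
  forall m a, component m a -> component (m + alpha) (D a).

Definition is_root alpha : Prop :=
  alpha <> 0 /\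
  exists D, [/\ derivation D, homogeneous D alpha & D <> 0].

Definition bracket D D' : A -> A := (D \o D') - (D' \o D).

(* The map induced by der alpha p on A, when der alpha p preserves I. *)
Definition dbar alpha (p : 'rV[K]_n) : A -> A :=
  fun a => \pi_A (der alpha p (repr a)).

(* E_alpha, through the indices of its elements. *)
Definition Eset alpha : {set 'I_n} :=
  [set i | inner (alpha + ev i) && (alpha + ev i \notin supp)]%SET.

(* Meaningful when alpha is a root; an outer root has exactly one negative
   coordinate, equal to -1. *)
Definition Nspace alpha : set 'rV[K]_n :=
  [set p | if inner alpha then forall i, i \notin Eset alpha -> p ord0 i = 0
           else exists2 k, alpha ord0 k = -1 & exists c : K, p = c *: ev_dual k].

Definition root_space alpha : set (A -> A) := dbar alpha @` Nspace alpha.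

Definition Bspace gamma : set (A -> A) :=
  lspan [set D | exists alpha beta D1 D2,
    [/\ is_root alpha /\ is_root beta, alpha + beta = gamma, root_space alpha D1,
        root_space beta D2 & D = bracket D1 D2]].

Definition mu gamma : nat := dim_quot (root_space gamma) (Bspace gamma).

Definition reducible gamma : Prop := Bspace gamma = root_space gamma.

Definition irreducible gamma : Prop := ~ reducible gamma.

End MonomialIdeals.

(* Sets over A -> A make I inferable from a further argument; keep I explicit. *)
Arguments component {K n} I m _.
Arguments root_space {K n} I alpha _.
Arguments Bspace {K n} I gamma _.
Arguments dbar {K n} I alpha p _.
Arguments Nspace {K n} I alpha _.

(* Main.v *)
Require Import Defs.
From HB Require Import structures.
From mathcomp Require Import all_boot all_order all_algebra.
From mathcomp Require Import boolp classical_sets functions.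
From mathcomp Require Import mpoly zify ring.
Import Order.TTheory GRing.Theory Num.Theory.
Local Open Scope ring_scope.
Local Open Scope classical_set_scope.

(** Write [a, p] for the derivation x^m |-> p(m) x^(m + a) of A, so that
    [[a, p], [b, q]] = [a + b, p(b) q - q(a) p].  In degree g = 2e_i only the
    directions e_j^* with e_j in E_g survive, so everything is decided by one
    number: the i-th coordinate r_i of r = p(b) q - q(a) p, for roots a, b with
    a + b = 2e_i.

    The hyperplane r_i = 0 is always reached.  If e_j is in E_g then e_j is in
    E_(e_i), so e_i is a root and [[e_i, e_i^*], [e_i, e_j^*]] = [2e_i, e_j^*]
    for j <> i ([offdiag_sub_Bspace]).  Hence B_g is g_g or this hyperplane,
    according to whether or not some bracket has r_i <> 0; if e_i is not in E_g,
    that is 3e_i is in supp(I), the hyperplane is already all of g_g.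

    Which brackets have r_i <> 0 is found by looking at the signs of a and b
    ([bracket_splitting]).  If both are inner they are nonzero with sum 2e_i, so
    both are e_i, and r_i = p_i q_i - q_i p_i = 0.  If a is outer with
    a_k = -1 and b is inner, then p is a multiple of e_k^* with k <> i, because
    k = i would force a = -e_i, which is never a root when the support is
    cofinite ([neg_ev_not_root]); so q_i <> 0, and enlarging a to 2e_i - e_k and
    shrinking b to e_k gives two roots whose bracket still has r_i <> 0.  If
    both are outer, r_i <> 0 makes one of them outer at i, and then the
    nonnegativity of the remaining coordinates leaves only
    {3e_i - e_k, e_k - e_i}.  Conversely these two decompositions give
    r = e_i^* - 2 e_k^* and r = e_i^* - 3 e_k^*.

    The notion of root quantifies over all homogeneous derivations of A.  It is
    made combinatorial by [homogeneous_derivation]: such a derivation is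
    determined by its values on the variables, and these are monomials of
    prescribed degree, so it has the form [a, p]. *)

Set Implicit Arguments.
Unset Strict Implicit.
Unset Printing Implicit Defensive.

(** * Exponent vectors and monomials *)

Section Exponents.
Context {n : nat}.
Implicit Types (a b m : 'rV[int]_n) (k j : 'I_n).

Lemma rowDE a b j : (a + b) ord0 j = a ord0 j + b ord0 j :> int.
Proof. by rewrite mxE. Qed.

Lemma rowNE a j : (- a) ord0 j = - a ord0 j :> int.
Proof. by rewrite mxE. Qed.

Lemma row0E j : fun_of_matrix (0 : 'rV[int]_n) ord0 j = 0.
Proof. by rewrite mxE. Qed.

Lemma row_ext a b : (forall j, a ord0 j = b ord0 j) -> a = b.
Proof. by move=> ab; apply/rowP. Qed.

Lemma innerP m : reflect (forall j, 0 <= m ord0 j) (inner m).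
Proof. exact: forallP. Qed.

Lemma inner0 : inner (0 : 'rV[int]_n).
Proof. by apply/innerP => j; rewrite mxE. Qed.

Lemma inner_addr a b : inner a -> inner b -> inner (a + b).
Proof.
by move=> /innerP ha /innerP hb; apply/innerP => j; rewrite rowDE addr_ge0.
Qed.

Lemma evE k j : (ev k) ord0 j = (j == k)%:R :> int.
Proof. by rewrite mxE eqxx. Qed.

Lemma inner_ev k : inner (ev k).
Proof. by apply/innerP => j; rewrite evE ler0n. Qed.

Lemma inner_ev_muln k r : inner (ev k *+ r).
Proof.
by elim: r => [|r IH]; rewrite ?mulr0n ?inner0 // mulrS inner_addr ?inner_ev.
Qed.

Lemma inner_of_mnm (m : 'X_{1..n}) : inner (of_mnm m).
Proof. by apply/innerP => j; rewrite mxE. Qed.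

Lemma of_mnmK : cancel (@of_mnm n) (@mnm_of n).
Proof. by move=> m; apply/mnmP => j; rewrite mnmE mxE. Qed.

Lemma mnm_ofK m : inner m -> of_mnm (mnm_of m) = m.
Proof. by move=> /innerP hm; apply/rowP => j; rewrite mxE mnmE gez0_abs. Qed.

Lemma mnm_ofD a b : inner a -> inner b -> mnm_of (a + b) = (mnm_of a + mnm_of b)%MM.
Proof.
move=> /innerP ha /innerP hb; apply/mnmP => j; rewrite mnmDE !mnmE rowDE.
by have := ha j; have := hb j; lia.
Qed.

Lemma of_mnmD (a b : 'X_{1..n}) : of_mnm (a + b)%MM = of_mnm a + of_mnm b.
Proof. by apply/rowP => j; rewrite !mxE mnmDE. Qed.

Lemma of_mnmU k : of_mnm U_(k)%MM = ev k.
Proof. by apply/rowP => j; rewrite evE mxE mnm1E eq_sym; case: eqP. Qed.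

Lemma inner_ind (P : 'rV[int]_n -> Prop) : P 0 ->
  (forall m k, inner m -> P m -> P (m + ev k)) -> forall m, inner m -> P m.
Proof.
move=> P0 PS m hm; rewrite -(mnm_ofK hm).
have [d] := ubnP (mdeg (mnm_of m)); elim: d (mnm_of m) => // d IH c hc.
case: (pickP (fun j => c j != 0%N)) => [j cj|c0].
  have jc : (U_(j) <= c)%MM by rewrite lep1mP.
  rewrite -(submK jc) of_mnmD of_mnmU; apply: PS; first exact: inner_of_mnm.
  apply: IH; move: hc; rewrite -{1}(submK jc) mdegD mdeg1; lia.
rewrite (_ : of_mnm c = 0) //; apply/rowP => j; rewrite !mxE.
by move: (c0 j) => /negbFE /eqP ->.
Qed.

Definition rowE := (rowDE, rowNE, row0E, evE).

End Exponents.

Section Pairing.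
Context {K : fieldType} {n : nat}.
Implicit Types (a b m : 'rV[int]_n) (k j : 'I_n) (p q : 'rV[K]_n).

Lemma pairingDr p a b : pairing p (a + b) = pairing p a + pairing p b.
Proof.
by rewrite /pairing -big_split; apply: eq_bigr => j _; rewrite mxE rmorphD mulrDr.
Qed.

Lemma pairing0r p : pairing p 0 = 0.
Proof. by rewrite /pairing big1 // => j _; rewrite mxE mulr0. Qed.

Lemma pairing_ev p k : pairing p (ev k) = p ord0 k.
Proof.
rewrite /pairing (bigD1 k) //= evE eqxx mulr1 big1 ?addr0 // => j /negbTE jk.
by rewrite evE jk mulr0.
Qed.

Lemma pairing_linear (c : K) p q m :
  pairing (c *: p + q) m = c * pairing p m + pairing q m.
Proof.
rewrite /pairing mulr_sumr -big_split; apply: eq_bigr => j _.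
by rewrite !mxE mulrDl mulrA.
Qed.

Lemma pairing0l m : pairing (0 : 'rV[K]_n) m = 0.
Proof. by rewrite /pairing big1 // => j _; rewrite mxE mul0r. Qed.

Lemma pairingZl (c : K) p m : pairing (c *: p) m = c * pairing p m.
Proof. by rewrite -[c *: p]addr0 pairing_linear pairing0l addr0. Qed.

Lemma ev_dualE k j : (ev_dual k : 'rV[K]_n) ord0 j = (j == k)%:R.
Proof. by rewrite mxE eqxx. Qed.

Lemma pairing_dual k m : pairing (ev_dual k : 'rV[K]_n) m = (m ord0 k)%:~R.
Proof.
rewrite /pairing (bigD1 k) //= ev_dualE eqxx mul1r big1 ?addr0 // => j /negbTE jk.
by rewrite ev_dualE jk mul0r.
Qed.

End Pairing.

Section Monomials.
Context {K : fieldType} {n : nat}.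
Implicit Types (a b m : 'rV[int]_n) (k j : 'I_n) (p q : 'rV[K]_n)
  (f g : {mpoly K[n]}).
Local Notation xm := (@xmon K n).

Lemma xmonD a b : inner a -> inner b -> xm (a + b) = xm a * xm b.
Proof. by move=> ha hb; rewrite /xmon inner_addr // ha hb mnm_ofD // mpolyXD. Qed.

Lemma xmon_of_mnm (m : 'X_{1..n}) : xm (of_mnm m) = 'X_[m].
Proof. by rewrite /xmon inner_of_mnm of_mnmK. Qed.

Lemma xmon_outer m : ~~ inner m -> xm m = 0.
Proof. by rewrite /xmon => /negbTE ->. Qed.

Lemma xmon0 : xm 0 = 1.
Proof.
rewrite /xmon inner0 (_ : mnm_of 0 = 0%MM) ?mpolyX0 //.
by apply/mnmP => j; rewrite mnmE mxE mnm0E.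
Qed.

(** Freeing the summation range from the support of f is what makes additivity
    in f visible. *)
Lemma derE a p f (s : seq 'X_{1..n}) : uniq s -> {subset msupp f <= s} ->
  der a p f =
  \sum_(m <- s) (f@_m * pairing p (of_mnm m)) *: xm (of_mnm m + a).
Proof.
move=> us sub; rewrite /der [RHS](bigID (mem (msupp f))) /=.
rewrite [X in _ + X]big1 ?addr0; last first.
  by move=> m; rewrite -mcoeff_eq0 => /eqP ->; rewrite mul0r scale0r.
rewrite -[RHS]big_filter; apply: perm_big; apply: uniq_perm.
- exact: msupp_uniq.
- exact: filter_uniq.
- by move=> m; rewrite mem_filter /=; case: (boolP (m \in msupp f)) => // /sub ->.
Qed.

Lemma der_linear a p : linear (der a p).
Proof.
move=> c f g; pose s := undup (msupp f ++ msupp g).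
have us : uniq s by exact: undup_uniq.
rewrite !(@derE _ _ _ s) //; last 3 first.
- by move=> m mg; rewrite mem_undup mem_cat mg orbT.
- by move=> m mf; rewrite mem_undup mem_cat mf.
- move=> m /msuppD_le; rewrite mem_undup !mem_cat => /orP[/msuppZ_le -> //|->].
  by rewrite orbT.
rewrite scaler_sumr -big_split; apply: eq_bigr => m _ /=.
by rewrite mcoeffD mcoeffZ mulrDl scalerDl -mulrA scalerA.
Qed.

Lemma der_sub a p f g : der a p (f - g) = der a p f - der a p g.
Proof. by rewrite addrC -scaleN1r der_linear scaleN1r addrC. Qed.

Lemma der_xmon a p m : inner m -> der a p (xm m) = pairing p m *: xm (m + a).
Proof.
by move=> hm; rewrite {1}/xmon hm /der msuppX big_seq1 mcoeffX eqxx mul1r mnm_ofK.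
Qed.

Lemma der_linearl a (c : K) p q f :
  der a (c *: p + q) f = c *: der a p f + der a q f.
Proof.
rewrite /der scaler_sumr -big_split; apply: eq_bigr => m _ /=.
by rewrite pairing_linear mulrDr scalerDl scalerA mulrCA.
Qed.

End Monomials.

Local Open Scope quotient_scope.

(** * The quotient algebra and its monomials *)

Section Quotient.
Context {K : fieldType} {n : nat} (I : idealr {mpoly K[n]}).
Local Notation A := {ideal_quot I}.
Implicit Types (a b m : 'rV[int]_n) (k j : 'I_n) (p q : 'rV[K]_n)
  (f g : {mpoly K[n]}) (D : A -> A).

Definition qmon m : A := \pi_A (xmon m).

Lemma quot_scalerAl (c : K) (u v : A) : c *: u * v = c *: (u * v).
Proof. by rewrite /GRing.scale /= /quot_scale mulrA. Qed.

Lemma quot_scalerAr (c : K) (u v : A) : u * (c *: v) = c *: (u * v).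
Proof. by rewrite mulrC quot_scalerAl mulrC. Qed.

Lemma linear_fun0 (U V : lmodType K) (F : U -> V) : linear F -> F 0 = 0.
Proof. by move=> /(_ (-1) 0 0); rewrite scaler0 addr0 scaleN1r addNr. Qed.

Lemma pi_eq0 f : (\pi_A f = 0) <-> (f \in I).
Proof.
rewrite -[f in f \in I]subr0 Quotient.idealrBE rmorph0.
by split=> [->|/eqP].
Qed.

Lemma qmonD a b : inner a -> inner b -> qmon (a + b) = qmon a * qmon b.
Proof. by move=> ha hb; rewrite /qmon xmonD // rmorphM. Qed.

Lemma qmon0 : qmon 0 = 1.
Proof. by rewrite /qmon xmon0 rmorph1. Qed.

Lemma qmon_outer m : ~~ inner m -> qmon m = 0.
Proof. by move=> hm; rewrite /qmon xmon_outer // rmorph0. Qed.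

Lemma supp_inner m : m \in supp I -> inner m.
Proof. by case/andP. Qed.

Lemma qmon_supp m : m \in supp I -> qmon m = 0.
Proof. by case/andP => hm mI; apply/pi_eq0; rewrite /xmon hm. Qed.

Lemma qmon_eq0 m : inner m -> qmon m = 0 -> m \in supp I.
Proof. by move=> hm; rewrite /qmon /xmon hm => /pi_eq0 mI; apply/andP. Qed.

Lemma supp_addr m d : m \in supp I -> inner d -> m + d \in supp I.
Proof.
move=> ms hd; apply: qmon_eq0; first by rewrite inner_addr // supp_inner.
by rewrite (qmonD (supp_inner ms) hd) (qmon_supp ms) mul0r.
Qed.

Lemma zero_notin_supp : 0 \notin supp I.
Proof.
apply/negP => /qmon_supp; rewrite qmon0 => /eqP; apply/negP.
exact: oner_neq0.
Qed.

Lemma EsetP a k : reflect (inner (a + ev k) /\ a + ev k \notin supp I)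
  (k \in Eset I a).
Proof. by rewrite finset.in_set; apply: andP. Qed.

Lemma qmon_Eset_neq0 a k : k \in Eset I a -> qmon (a + ev k) <> 0.
Proof. by move=> /EsetP[hk /negP ks] /(qmon_eq0 hk). Qed.

Lemma qmon_notin_Eset a k : k \notin Eset I a -> qmon (a + ev k) = 0.
Proof.
rewrite finset.in_set; case: (boolP (inner _)) => [hk|/qmon_outer//].
by rewrite negbK => /qmon_supp.
Qed.

Lemma linear_qmon_ext (V : lmodType K) (F G : A -> V) : linear F -> linear G ->
  (forall m, inner m -> F (qmon m) = G (qmon m)) -> F =1 G.
Proof.
move=> lF lG FG x; rewrite -[x]reprK.
elim/mpolyind: (repr x) => [|c m f _ _ IH]; first by rewrite rmorph0 !linear_fun0.
by rewrite rmorphD /= quot_piZ lF lG IH -xmon_of_mnm FG // inner_of_mnm.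
Qed.

Lemma derivation_qmon D : linear D ->
  (forall a b, inner a -> inner b ->
     D (qmon a * qmon b) = D (qmon a) * qmon b + qmon a * D (qmon b)) ->
  derivation D.
Proof.
move=> lD DM; split=> // x y.
apply: (@linear_qmon_ext A (fun x => D (x * y))
  (fun x => D x * y + x * D y)).
- by move=> c u v; rewrite mulrDl quot_scalerAl lD.
- by move=> c u v; rewrite lD !mulrDl !quot_scalerAl scalerDr addrACA.
move=> a ha.
apply: (@linear_qmon_ext A (fun y => D (qmon a * y))
  (fun y => D (qmon a) * y + qmon a * D y)).
- by move=> c u v; rewrite mulrDr quot_scalerAr lD.
- by move=> c u v; rewrite lD !mulrDr !quot_scalerAr scalerDr addrACA.
by move=> b hb; exact: DM.
Qed.

(** * Derivations given by a degree and a linear form *)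

Hypothesis I_monomial : monomial_ideal I.

(** The monomials of a multiple of a generator are themselves multiples of it,
    so a monomial ideal contains each monomial of each of its elements. *)
Lemma monomial_ideal_msupp f (m : 'X_{1..n}) :
  f \in I -> m \in msupp f -> 'X_[m] \in I.
Proof.
case: I_monomial => G GI /GI[r [q [c [cG ->]]]] /msupp_sum_le.
rewrite filter_predT => /flatten_mapP[j _]; rewrite (perm_mem (msuppMX _ _)).
move=> /mapP[d _ ->]; rewrite mpolyXD mulrC idealMr //; apply/GI.
by exists 1%N, (fun=> 1), (fun=> c j); rewrite big_ord1 mul1r.
Qed.

(** The condition for x^m |-> p(m) x^(m + a) to preserve both K[x] and I, that
    is for [dbar I a p] to be the derivation of A which it is meant to be. *)
Definition admissible a p := forall m, inner m -> pairing p m <> 0 ->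
  inner (m + a) /\ (m \in supp I -> m + a \in supp I).

Lemma der_ideal a p f : admissible a p -> f \in I -> der a p f \in I.
Proof.
move=> adm fI; rewrite /der big_seq; apply: rpred_sum => m mf.
have mI := monomial_ideal_msupp fI mf.
have ms : of_mnm m \in supp I by apply/andP; rewrite inner_of_mnm of_mnmK.
have [->|/eqP p0] := eqVneq (pairing p (of_mnm m)) 0.
  by rewrite mulr0 scale0r rpred0.
have [h /(_ ms)/andP[_ aI]] := adm _ (inner_of_mnm m) p0.
by rewrite -mul_mpolyC idealMr // /xmon h.
Qed.

Lemma dbar_pi a p f : admissible a p -> dbar I a p (\pi_A f) = \pi_A (der a p f).
Proof.
move=> adm; apply/eqP; rewrite -subr_eq0 -rmorphB -der_sub /=; apply/eqP/pi_eq0.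
apply: der_ideal => //; rewrite Quotient.idealrBE; apply/eqP; exact: reprK.
Qed.

Lemma dbar_qmon a p m : admissible a p -> inner m ->
  dbar I a p (qmon m) = pairing p m *: qmon (m + a).
Proof. by move=> adm hm; rewrite /qmon dbar_pi // der_xmon // quot_piZ. Qed.

Lemma dbar_linear a p : admissible a p -> linear (dbar I a p).
Proof.
move=> adm c x y; rewrite -[x]reprK -[y]reprK -quot_piZ -rmorphD !dbar_pi //.
by rewrite der_linear rmorphD /= quot_piZ.
Qed.

Lemma dbar_linearl a : linear (dbar I a).
Proof.
move=> c p q; apply/funext => x.
by rewrite /dbar der_linearl rmorphD /= quot_piZ.
Qed.

Lemma dbar_derivation a p : admissible a p -> derivation (dbar I a p).
Proof.
move=> adm; apply: derivation_qmon; first exact: dbar_linear.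
move=> b c hb hc; rewrite -qmonD // !dbar_qmon ?inner_addr // pairingDr scalerDl.
rewrite quot_scalerAl quot_scalerAr; congr (_ + _).
  have [->|/eqP p0] := eqVneq (pairing p b) 0; first by rewrite !scale0r.
  by have [h _] := adm _ hb p0; rewrite -qmonD // addrAC.
have [->|/eqP p0] := eqVneq (pairing p c) 0; first by rewrite !scale0r.
by have [h _] := adm _ hc p0; rewrite -qmonD // addrA.
Qed.

End Quotient.

Section Roots.
Context {K : fieldType} {n : nat} (I : idealr {mpoly K[n]}).
Local Notation A := {ideal_quot I}.
Implicit Types (a b m : 'rV[int]_n) (j k : 'I_n) (p q : 'rV[K]_n) (D : A -> A).
Hypothesis I_monomial : monomial_ideal I.

Lemma admissible_inner a p : inner a -> admissible I a p.
Proof. by move=> ha m hm _; split; [exact: inner_addr | move/supp_addr; apply]. Qed.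

Lemma admissibleZ a (c : K) p : admissible I a p -> admissible I a (c *: p).
Proof.
move=> adm m hm; rewrite pairingZl => /eqP; rewrite mulf_eq0 negb_or.
by move=> /andP[_ /eqP]; exact: adm.
Qed.

(** If x_k has a nonzero image in degree a, then a + e_k is inner, so m + a is
    inner as soon as m_k > 0; only the stability of I is left to ask for. *)
Lemma admissible_dual a k : k \in Eset I a ->
  (forall m, m \in supp I -> inner (m + a) -> m + a \in supp I) ->
  admissible I a (ev_dual k).
Proof.
move=> /EsetP[/innerP hk _] cl m hm; rewrite pairing_dual => mk.
have mk0 : m ord0 k != 0 by apply: contra_notN mk => /eqP ->.
suff hma : inner (m + a) by split=> // ms; exact: cl.
apply/innerP => j; move/innerP: hm => /(_ j).
by move: (hk j); rewrite !rowE; case: eqP => [->|_] /=; move: mk0; lia.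
Qed.

Lemma admissible_bracket a b p q : admissible I a p -> admissible I b q ->
  admissible I (a + b) (pairing p b *: q - pairing q a *: p).
Proof.
move=> admp admq m hm.
have -> : pairing (pairing p b *: q - pairing q a *: p) m =
    pairing q m * pairing p (m + b) - pairing p m * pairing q (m + a).
  rewrite -scaleNr pairing_linear pairingZl !pairingDr; ring.
have [->|/eqP q0] := eqVneq (pairing q m * pairing p (m + b)) 0.
  rewrite sub0r => /eqP; rewrite oppr_eq0 mulf_eq0 negb_or => /andP[/eqP p0 /eqP q0].
  have [ha sa] := admp _ hm p0; have [hb sb] := admq _ ha q0.
  by rewrite addrA; split=> // /sa/sb.
move/eqP: q0; rewrite mulf_eq0 negb_or => /andP[/eqP q0 /eqP p0] _.
have [hb sb] := admq _ hm q0; have [ha sa] := admp _ hb p0.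
by rewrite [a + b]addrC addrA; split=> // /sb/sa.
Qed.

Lemma dbar0 a p : admissible I a p -> dbar I a p 0 = 0.
Proof. by move=> adm; exact/linear_fun0/dbar_linear. Qed.

Lemma dbarZ a p (c : K) x : admissible I a p ->
  dbar I a p (c *: x) = c *: dbar I a p x.
Proof. by move=> adm; rewrite -[c *: x]addr0 dbar_linear // dbar0 // addr0. Qed.

(** On monomials the difference of the two compositions has the coefficient
    q(m) p(m + b) - p(m) q(m + a) = q(m) p(b) - p(m) q(a). *)
Lemma bracket_dbar a b p q : admissible I a p -> admissible I b q ->
  bracket (dbar I a p) (dbar I b q) =
  dbar I (a + b) (pairing p b *: q - pairing q a *: p).
Proof.
move=> admp admq; apply/funext/linear_qmon_ext.
- move=> c x y; rewrite /bracket !fctE /= !dbar_linear //.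
  by rewrite scalerBr opprD addrACA.
- exact/dbar_linear/admissible_bracket.
have comp_qmon a' b' p' q' m : admissible I a' p' -> admissible I b' q' ->
    inner m -> dbar I a' p' (dbar I b' q' (qmon I m)) =
      (pairing q' m * pairing p' (m + b')) *: qmon I (m + b' + a').
  move=> adm' adm2 hm; rewrite dbar_qmon //.
  have [->|/eqP q0] := eqVneq (pairing q' m) 0.
    by rewrite mul0r !scale0r dbar0.
  have [hb _] := adm2 _ hm q0.
  by rewrite dbarZ // dbar_qmon // scalerA.
move=> m hm; rewrite /bracket !fctE /= !comp_qmon //.
rewrite dbar_qmon //; last exact: admissible_bracket.
rewrite [a + b]addrC addrA [m + a + b]addrAC -scalerBl; congr (_ *: _).
rewrite -[- (pairing q a *: p)]scaleNr pairing_linear pairingZl !pairingDr; ring.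
Qed.

(** The vector p collects the coefficients of the D(x_k), with 0 where the
    monomial x^(a + e_k) vanishes in A; the Leibniz rule then gives D on all
    monomials.  That p is admissible costs nothing: if x^m is in I then
    0 = D(x^m) = p(m) x^(m + a). *)
Lemma homogeneous_derivation D a : derivation D -> homogeneous D a ->
  exists p, [/\ forall k, k \notin Eset I a -> p ord0 k = 0,
                admissible I a p & D = dbar I a p].
Proof.
move=> [lD DM] hD.
have /choice[c Dc] k : exists c : K, D (qmon I (ev k)) = c *: qmon I (ev k + a).
  by apply: hD; exists 1; rewrite scale1r.
pose p : 'rV[K]_n := \row_k (if k \in Eset I a then c k else 0).
have pE k : p ord0 k = if k \in Eset I a then c k else 0 by rewrite mxE.
have p0 k : k \notin Eset I a -> p ord0 k = 0 by rewrite pE => /negbTE ->.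
have Dp k : D (qmon I (ev k)) = p ord0 k *: qmon I (a + ev k).
  rewrite Dc pE addrC; case: ifP => // /negbT /qmon_notin_Eset ->.
  by rewrite !scaler0.
(* If p(m) <> 0 then p_k <> 0 and m_k > 0 for some k, and a + e_k is inner. *)
have adm1 m : inner m -> pairing p m <> 0 -> inner (m + a).
  move=> hm /eqP pm; have /existsP[k] : [exists k, p ord0 k * (m ord0 k)%:~R != 0].
    apply: contraNT pm => /existsPn pk; rewrite /pairing big1 // => k _.
    by apply/eqP; rewrite -[_ == _]negbK pk.
  rewrite mulf_eq0 negb_or => /andP[pk mk].
  have /EsetP[hak _] : k \in Eset I a by apply: contraNT pk => /p0 ->.
  have mk0 : m ord0 k != 0 by apply: contraNneq mk => ->.
  apply/innerP => j; move/innerP: hm => /(_ j); move/innerP: hak => /(_ j).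
  by rewrite !rowE; case: eqP => [->|_] /=; move: mk0; lia.
have D1 : D 1 = 0.
  have := DM 1 1; rewrite !mulr1 mul1r => /eqP.
  by rewrite eq_sym -subr_eq0 addrK => /eqP.
have DE m : inner m -> D (qmon I m) = pairing p m *: qmon I (m + a).
  move: m; apply: inner_ind => [|m k hm IH].
    by rewrite qmon0 D1 pairing0r scale0r.
  rewrite qmonD // ?inner_ev // DM IH Dp pairingDr pairing_ev scalerDl.
  rewrite quot_scalerAl quot_scalerAr; congr (_ + _).
    have [->|/eqP pm] := eqVneq (pairing p m) 0; first by rewrite !scale0r.
    by rewrite -qmonD ?inner_ev ?adm1 // addrAC.
  have [/EsetP[hk _]|/p0->] := boolP (k \in Eset I a); last by rewrite !scale0r.
  by rewrite -qmonD // addrA addrAC.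
have D0 : D 0 = 0 by exact: linear_fun0.
have adm : admissible I a p.
  move=> m hm pm; have hma := adm1 _ hm pm; split=> // ms.
  apply: qmon_eq0 => //; have := DE _ hm; rewrite qmon_supp // D0 => /esym/eqP.
  by rewrite scaler_eq0 => /orP[/eqP//|/eqP].
exists p; split=> //; apply/funext/linear_qmon_ext => //; first exact: dbar_linear.
by move=> m hm; rewrite DE // dbar_qmon.
Qed.

Lemma dbar_homogeneous a p : admissible I a p -> homogeneous (dbar I a p) a.
Proof.
move=> adm m x [c ->].
have [hm|/qmon_outer hm] := boolP (inner m); last first.
  by exists 0; rewrite -/(qmon I m) hm scaler0 scale0r dbar0.
exists (c * pairing p m); rewrite -scalerA -/(qmon I (m + a)) -(dbar_qmon _ adm) //.
by rewrite -/(qmon I m) dbarZ.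
Qed.

Lemma dbar_dual_qmon a j k : admissible I a (ev_dual j) ->
  dbar I a (ev_dual j) (qmon I (ev k)) = (k == j)%:R *: qmon I (a + ev k).
Proof.
by move=> adm; rewrite dbar_qmon ?inner_ev // pairing_ev ev_dualE addrC.
Qed.

(** * Roots *)

Lemma is_root_dual a k : a <> 0 -> k \in Eset I a -> admissible I a (ev_dual k) ->
  is_root I a.
Proof.
move=> a0 ka adm; split=> //; exists (dbar I a (ev_dual k)); split.
- exact: dbar_derivation.
- exact: dbar_homogeneous.
move=> d0; apply: (qmon_Eset_neq0 ka).
by have := dbar_dual_qmon k adm; rewrite d0 eqxx scale1r.
Qed.

Lemma root_pairing a : is_root I a ->
  exists2 p : 'rV[K]_n, admissible I a p &
  exists2 k, k \in Eset I a & p ord0 k != 0 /\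
    forall j, j \notin Eset I a -> p ord0 j = 0.
Proof.
move=> [_ [D [dD hD D0]]]; have [p [p0 adm DE]] := homogeneous_derivation dD hD.
exists p => //; have /existsP[k pk] : [exists k, p ord0 k != 0].
  apply: contra_notT D0 => /existsPn pk; rewrite DE.
  have -> : p = 0.
    by apply/rowP => j; rewrite mxE; apply/eqP; rewrite -[_ == _]negbK pk.
  exact/linear_fun0/dbar_linearl.
by exists k => //; apply: contraNT pk => /p0 ->.
Qed.

(** In an outer degree only one variable can have a nonzero image, the one
    whose exponent repairs the negative coordinate. *)
Lemma Eset_outer a j k : a ord0 k < 0 -> j \in Eset I a -> j = k.
Proof.
move=> ak /EsetP[/innerP /(_ k) + _]; rewrite !rowE; case: eqP => // _.
by move: ak; lia.
Qed.

Lemma outer_root a : is_root I a -> ~~ inner a ->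
  exists k, a ord0 k = -1 /\ k \in Eset I a.
Proof.
move=> /root_pairing[p _ [k kE _]] /forallPn[l]; rewrite -ltNge => al.
exists k; split=> //; have kl := Eset_outer al kE; rewrite -kl in al.
move/EsetP: kE => [/innerP /(_ k) + _]; rewrite !rowE eqxx; move: al; lia.
Qed.

Hypothesis charK0 : [pchar K] =i pred0.

Lemma intr_eq0_char0 (z : int) : (z%:~R == 0 :> K) = (z == 0).
Proof.
move/pcharf0P: charK0 => ch; case: z => m; first by rewrite -pmulrn ch.
by rewrite NegzE mulrNz oppr_eq0 -pmulrn ch.
Qed.

(** If x^m is in I and m + a is inner, then m_k > 0, and the characteristic
    ensures that x^(m + a) really occurs in the image of x^m. *)
Lemma is_root_outer a k : a ord0 k = -1 ->
  is_root I a <-> k \in Eset I a /\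
    forall m, m \in supp I -> inner (m + a) -> m + a \in supp I.
Proof.
move=> ak; have ak0 : a ord0 k < 0 by rewrite ak.
split=> [/root_pairing[p adm [l kE [pl p0]]]|[kE cl]].
  have lk := Eset_outer ak0 kE; rewrite lk in kE pl; split=> // m ms hma.
  suff pm : pairing p m <> 0 by have [_] := adm m (supp_inner ms) pm; apply.
  have -> : p = p ord0 k *: ev_dual k.
    apply/rowP => j; rewrite mxE ev_dualE.
    have [->|/eqP jk] := eqVneq j k; first by rewrite mulr1.
    by rewrite mulr0 p0 //; apply/negP => /(Eset_outer ak0).
  rewrite pairingZl pairing_dual => /eqP; rewrite mulf_eq0 (negbTE pl) /=.
  rewrite intr_eq0_char0 => /eqP mk; move/innerP: hma => /(_ k).
  by rewrite rowDE mk ak.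
apply: (is_root_dual _ kE); last exact: admissible_dual.
by move=> a0; rewrite a0 row0E in ak.
Qed.

Lemma is_root_inner a k : a <> 0 -> inner a -> k \in Eset I a -> is_root I a.
Proof. by move=> a0 ha kE; apply: (is_root_dual a0 kE); exact: admissible_inner. Qed.

Lemma Nspace_inner a p k : inner a -> Nspace I a p -> p ord0 k != 0 ->
  k \in Eset I a.
Proof. by move=> ha; rewrite /Nspace /= ha => p0; apply: contraNT => /p0/eqP. Qed.

Lemma Nspace_outer a p k : a ord0 k = -1 -> k \in Eset I a -> Nspace I a p ->
  exists c, p = c *: ev_dual k.
Proof.
move=> ak kE; rewrite /Nspace /=; have /negbTE -> : ~~ inner a.
  by apply/negP => /innerP /(_ k); rewrite ak.
move=> [l al [c pE]]; exists c; rewrite (@Eset_outer a k l) //; last by rewrite al.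
by apply/matrixP => i j; rewrite pE.
Qed.

Lemma Nspace_dual_outer a k : a ord0 k = -1 -> Nspace I a (ev_dual k).
Proof.
move=> ak; rewrite /Nspace /=; have /negbTE -> : ~~ inner a.
  by apply/negP => /innerP /(_ k); rewrite ak.
by exists k => //; exists 1; rewrite scale1r.
Qed.

Lemma Nspace_dual_inner a k : inner a -> k \in Eset I a -> Nspace I a (ev_dual k).
Proof.
move=> ha kE; rewrite /Nspace /= ha => j jE; rewrite ev_dualE.
by case: eqP jE => // ->; rewrite kE.
Qed.

Lemma Nspace_admissible a p : is_root I a -> Nspace I a p -> admissible I a p.
Proof.
have [ha _ _|ha ra] := boolP (inner a); first exact: admissible_inner.
have [k [ak kE]] := outer_root ra ha.
move=> /(Nspace_outer ak kE)[c ->]; have [_ cl] := (is_root_outer ak).1 ra.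
by apply: admissibleZ; exact: admissible_dual.
Qed.

End Roots.

(** * Spans and quotient dimensions *)

Section LinearAlgebraLemmas.
Context {K : fieldType} {U : lmodType K}.
Implicit Types (X V W : set U).

Lemma subspaceD W u v : subspace W -> W u -> W v -> W (u + v).
Proof. by move=> [_ lW] Wu Wv; rewrite -[u]scale1r; exact: lW. Qed.

Lemma subspaceZ W (c : K) u : subspace W -> W u -> W (c *: u).
Proof. by move=> [W0 lW] Wu; rewrite -[c *: u]addr0; exact: lW. Qed.

Lemma subspace_sum W (T : finType) (F : T -> U) :
  subspace W -> (forall j, W (F j)) -> W (\sum_j F j).
Proof.
move=> sW WF; elim/big_ind: _ => //; first by case: sW.
by move=> u v; exact: subspaceD.
Qed.

Lemma lspan_subset X : X `<=` lspan X.
Proof.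
move=> u Xu; exists 1%N, (fun=> 1), (fun=> u); split=> //.
by rewrite big_ord1 scale1r.
Qed.

Lemma lspan_subspace X : subspace (lspan X).
Proof.
split; first by exists 0%N, (fun=> 0), (fun=> 0); split=> [[]//|]; rewrite big_ord0.
move=> c u v [r [d [x [Xx ->]]]] [s [e [y [Xy ->]]]].
exists (r + s)%N,
  (fun j => match fintype.split j with inl l => c * d l | inr l => e l end),
  (fun j => match fintype.split j with inl l => x l | inr l => y l end).
split; first by move=> j; case: fintype.split.
rewrite big_split_ord /= scaler_sumr; congr (_ + _); apply: eq_bigr => l _.
  by rewrite (unsplitK (inl l)) scalerA.
by rewrite (unsplitK (inr l)).
Qed.

Lemma lspan_least X W : subspace W -> X `<=` W -> lspan X `<=` W.
Proof.
move=> sW XW u [r [c [v [Xv ->]]]]; apply: subspace_sum => // j.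
by apply: subspaceZ => //; exact: XW.
Qed.

(** If d > e, the matrix expressing the first basis modulo W through the second
    has a nonzero left kernel vector, which gives 0 a second expansion. *)
Lemma is_dim_quot_leq V W d e : subspace V -> subspace W ->
  is_dim_quot V W d -> is_dim_quot V W e -> (d <= e)%N.
Proof.
move=> sV sW [v [Vv vB]] [w [_ wB]]; rewrite leqNgt; apply/negP => lt_ed.
have /choice[C CE] j : exists c : 'rV[K]_e, W (v j - \sum_l c ord0 l *: w l).
  by have [c [Wc _]] := wB _ (Vv j); exists c.
pose M : 'M[K]_(d, e) := \matrix_(j, l) C j ord0 l.
have [x xM x0] : exists2 x : 'rV[K]_d, x *m M = 0 & x != 0.
  have : kermx M != 0.
    rewrite -mxrank_eq0 mxrank_ker subn_eq0 -ltnNge.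
    exact: leq_ltn_trans (rank_leq_col M) lt_ed.
  move=> /rowV0Pn[x /sub_kermxP xM x0]; by exists x.
have W0 : W (0 - \sum_j x ord0 j *: v j).
  have -> : 0 - \sum_j x ord0 j *: v j =
      \sum_j (- x ord0 j) *: (v j - \sum_l C j ord0 l *: w l).
    rewrite sub0r -sumrN.
    have -> : \sum_j (- x ord0 j) *: (v j - \sum_l C j ord0 l *: w l) =
      \sum_j - (x ord0 j *: v j) + \sum_j \sum_l (x ord0 j * M j l) *: w l.
      rewrite -big_split; apply: eq_bigr => j _ /=.
      rewrite scaleNr scalerBr opprB addrC; congr (_ + _).
      by rewrite scaler_sumr; apply: eq_bigr => l _; rewrite scalerA mxE.
    rewrite exchange_big /= [X in _ + X]big1 ?addr0 // => l _.
    rewrite -scaler_suml; have /matrixP/(_ ord0 l) := xM.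
    by rewrite !mxE => ->; rewrite scale0r.
  by apply: subspace_sum => // j; exact: subspaceZ.
have [c [_ uc]] := vB 0 sV.1; have cx := uc _ W0.
have c0 : c = 0.
  apply: uc; rewrite big1 ?subr0 => [|j _]; first exact: sW.1.
  by rewrite mxE scale0r.
by rewrite -cx c0 eqxx in x0.
Qed.

Lemma dim_quotE V W d : subspace V -> subspace W ->
  is_dim_quot V W d -> dim_quot V W = d.
Proof.
move=> sV sW Vd; apply: xget_unique => // e Ve.
by apply/eqP; rewrite eqn_leq !(is_dim_quot_leq sV sW).
Qed.

End LinearAlgebraLemmas.

(** * Brackets landing in an inner degree *)

Section InnerDegree.
Context {K : fieldType} {n : nat} (I : idealr {mpoly K[n]}).
Implicit Types (a b m d g : 'rV[int]_n) (i j k : 'I_n) (p q : 'rV[K]_n).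
Hypothesis I_monomial : monomial_ideal I.

Lemma dbar_dual_notin_Eset g j : inner g -> j \notin Eset I g ->
  dbar I g (ev_dual j) = 0.
Proof.
move=> hg jE; have adm : admissible I g (ev_dual j) by exact: admissible_inner.
apply/funext/linear_qmon_ext; first exact: dbar_linear.
  move=> c x y; change (0 = c *: 0 + 0 :> {ideal_quot I}).
  by rewrite scaler0 addr0.
move=> m hm; change (dbar I g (ev_dual j) (qmon I m) = 0).
rewrite dbar_qmon // pairing_dual.
have [->|mj] := eqVneq (m ord0 j) 0; first by rewrite scale0r.
have hmj : inner (m - ev j).
  apply/innerP => l; move/innerP: hm => /(_ l); rewrite !rowE.
  by case: eqP => [->|_] /=; move: mj; lia.
have -> : m + g = (m - ev j) + (g + ev j) by rewrite addrCA subrK addrC.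
have [hgj|hgj] := boolP (inner (g + ev j)).
  by rewrite qmonD // qmon_notin_Eset // mulr0 scaler0.
by case/negP: hgj; rewrite inner_addr ?inner_ev.
Qed.

(** Only the coordinates of p indexed by E_g contribute to [dbar I g p]. *)
Lemma dbar_mem g p (W : set ({ideal_quot I} -> {ideal_quot I})) :
  subspace W -> inner g ->
  (forall j, p ord0 j != 0 -> j \in Eset I g -> W (dbar I g (ev_dual j))) ->
  W (dbar I g p).
Proof.
move=> sW hg Wp.
have sV : subspace [set q | W (dbar I g q)].
  split=> [|c q q' Wq Wq'] /=; last by rewrite dbar_linearl; exact: sW.2.
  by rewrite (linear_fun0 (dbar_linearl I g)); exact: sW.1.
rewrite [p]row_sum_delta; apply: (subspace_sum sV) => j.
have [->|pj] := eqVneq (p ord0 j) 0; first by rewrite scale0r; exact: sV.1.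
apply: (subspaceZ _ sV) => /=; have [/(Wp _ pj)//|jE] := boolP (j \in Eset I g).
by rewrite -/(ev_dual j) dbar_dual_notin_Eset //; exact: sW.1.
Qed.

Lemma root_space_subspace g : inner g -> subspace (root_space I g).
Proof.
move=> hg; split.
  exists 0; first by rewrite /Nspace /= hg => j _; rewrite mxE.
  exact/linear_fun0/dbar_linearl.
move=> c _ _ [p Np <-] [q Nq <-]; exists (c *: p + q); last exact: dbar_linearl.
move: Np Nq; rewrite /Nspace /= hg => Np Nq j jE.
by rewrite !mxE Np // Nq // mulr0 addr0.
Qed.

Lemma dbar_root_space g p : inner g -> root_space I g (dbar I g p).
Proof.
move=> hg; apply: dbar_mem => //; first exact: root_space_subspace.
by move=> j _ jE; exists (ev_dual j) => //; exact: Nspace_dual_inner.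
Qed.

Hypothesis charK0 : [pchar K] =i pred0.

Lemma Bspace_least g (W : set ({ideal_quot I} -> {ideal_quot I})) :
  subspace W ->
  (forall a b p q, is_root I a -> is_root I b -> a + b = g ->
     Nspace I a p -> Nspace I b q ->
     W (dbar I g (pairing p b *: q - pairing q a *: p))) ->
  Bspace I g `<=` W.
Proof.
move=> sW WB; apply: lspan_least => //.
move=> _ [a [b [D1 [D2 [[ra rb] abg [p Np <-] [q Nq <-] ->]]]]].
have admp := Nspace_admissible I_monomial charK0 ra Np.
have admq := Nspace_admissible I_monomial charK0 rb Nq.
by rewrite bracket_dbar // abg; exact: WB.
Qed.

Lemma Bspace_bracket a b p q : is_root I a -> is_root I b ->
  Nspace I a p -> Nspace I b q ->
  Bspace I (a + b) (dbar I (a + b) (pairing p b *: q - pairing q a *: p)).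
Proof.
move=> ra rb Np Nq; apply: lspan_subset.
exists a, b, (dbar I a p), (dbar I b q); split=> //; [by exists p|by exists q|].
by rewrite bracket_dbar //; exact: Nspace_admissible.
Qed.

Lemma Bspace_sub_root_space g : inner g -> Bspace I g `<=` root_space I g.
Proof.
move=> hg; apply: Bspace_least; first exact: root_space_subspace.
by move=> *; exact: dbar_root_space.
Qed.

(** Outer roots can be shifted by d with d_k = 0: if m + a + d is inner then
    m_k > 0, so m + a is inner and already in the support, and adding d keeps
    it there. *)
Lemma outer_root_addr a d k : a ord0 k = -1 -> inner d -> d ord0 k = 0 ->
  is_root I a -> a + d + ev k \notin supp I -> is_root I (a + d).
Proof.
move=> ak hd dk /(is_root_outer I_monomial charK0 ak)[/EsetP[kE _] cl] ads.
apply/(is_root_outer I_monomial charK0 (k := k)); first by rewrite rowDE ak dk.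
split; first by apply/EsetP; rewrite addrAC inner_addr // addrAC.
move=> m ms hmad.
suff hma : inner (m + a) by rewrite addrA supp_addr // cl.
apply/innerP => j; move/innerP: hmad => /(_ j); move/innerP: kE => /(_ j).
have := supp_inner ms => /innerP /(_ j).
by rewrite !rowE; case: eqP => [->|_]; rewrite ?dk ?ak /=; lia.
Qed.

Hypothesis I_cofinite : cofinite_support I.

Lemma cofinite_pow k : exists r, ev k *+ r \in supp I.
Proof.
have [s sP] := I_cofinite; apply: contrapT => /forallNP Ns.
pose t := [seq ev k *+ r | r <- iota 0 (size s).+1].
suff [ut ts] : uniq t /\ {subset t <= s}.
  by have := uniq_leq_size ut ts; rewrite size_map size_iota ltnn.
split.
  rewrite map_inj_uniq ?iota_uniq // => r r' /rowP/(_ k).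
  by rewrite !mulmxnE !evE eqxx; lia.
move=> _ /mapP[r _ ->]; apply: sP; last exact/negP/Ns.
exact: inner_ev_muln.
Qed.

(** A root -e_k would carry a power of x_k in I down to 1. *)
Lemma neg_ev_not_root k : ~ is_root I (- ev k).
Proof.
have Nk : (- ev k) ord0 k = -1 by rewrite rowNE evE eqxx.
move=> /(is_root_outer I_monomial charK0 Nk)[_ cl].
have [r] := cofinite_pow k; elim: r => [|r IH].
  by rewrite mulr0n; exact/negP/zero_notin_supp.
by rewrite mulrSr => /cl; rewrite addrK => /(_ (inner_ev_muln k r)).
Qed.

End InnerDegree.

(** * Decompositions of 2e_i into two roots *)

Section TwiceBasisVector.
Context {K : fieldType} {n : nat} (I : idealr {mpoly K[n]}).
Implicit Types (a b c d m : 'rV[int]_n) (i j k l : 'I_n) (p q : 'rV[K]_n).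
Hypothesis I_monomial : monomial_ideal I.
Hypothesis charK0 : [pchar K] =i pred0.
Hypothesis I_cofinite : cofinite_support I.

Lemma bracket_coordN a b p q i :
  (pairing p b *: q - pairing q a *: p) ord0 i =
  - (pairing q a *: p - pairing p b *: q) ord0 i.
Proof. by rewrite !mxE opprB. Qed.

(** As e_i + e_k is outside the support, e_i lies in E_(e_k), so that e_k is an
    inner root and 2e_i = (2e_i - e_k) + e_k a sum of two roots. *)
Definition mixed_splitting i := exists k : 'I_n,
  [/\ k != i, is_root I (ev i *+ 2 - ev k) & ev i + ev k \notin supp I].

Definition outer_splitting i := exists k : 'I_n,
  [/\ k != i, is_root I (ev k - ev i) & is_root I (ev i *+ 3 - ev k)].

Lemma coord_sum a b i j : a + b = ev i *+ 2 ->
  a ord0 j + b ord0 j = (j == i)%:R + (j == i)%:R.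
Proof. by move=> /rowP/(_ j); rewrite mulr2n !rowE. Qed.

Lemma bracket_inner_inner a b p q i : a <> 0 -> b <> 0 -> inner a -> inner b ->
  a + b = ev i *+ 2 -> (pairing p b *: q - pairing q a *: p) ord0 i = 0.
Proof.
have half c d : c <> 0 -> d <> 0 -> inner c -> inner d -> c + d = ev i *+ 2 ->
    c = ev i.
  move=> c0 d0 /innerP hc /innerP hd cd.
  have off j : j != i -> c ord0 j = 0 /\ d ord0 j = 0.
    move=> /negbTE ji; have := coord_sum j cd; rewrite ji /=.
    by move: (hc j) (hd j); lia.
  have ci : c ord0 i != 0.
    apply: contra_notN c0 => /eqP ci; apply: row_ext => j; rewrite row0E.
    by have [->//|/off[]] := eqVneq j i.
  have di : d ord0 i != 0.
    apply: contra_notN d0 => /eqP di; apply: row_ext => j; rewrite row0E.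
    by have [->//|/off[]] := eqVneq j i.
  apply: row_ext => j; rewrite evE; have [->|/off[-> _]//] := eqVneq j i.
  by have := coord_sum i cd; rewrite eqxx /=; move: (hc i) (hd i) ci di; lia.
move=> a0 b0 ha hb ab; have -> := half _ _ a0 b0 ha hb ab.
have -> : b = ev i by apply: half b0 a0 hb ha _; rewrite addrC.
rewrite !pairing_ev !mxE; ring.
Qed.

(** Here a = s e_i - e_k and b = (2 - s) e_i + e_k, and r_i <> 0 puts e_i in E_b.
    As 2e_i - e_k = a + (2 - s) e_i, it is a root along with a; as e_i + e_k
    is at most b + e_i, it is outside the support along with b + e_i. *)
Lemma bracket_outer_inner a b p q i : ev i *+ 2 \notin supp I ->
  is_root I a -> ~~ inner a -> inner b -> a + b = ev i *+ 2 ->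
  Nspace I a p -> Nspace I b q ->
  (pairing p b *: q - pairing q a *: p) ord0 i != 0 -> mixed_splitting i.
Proof.
move=> i2 ra oa hb ab Np Nq r0.
have [k [ak kE]] := outer_root I_monomial ra oa.
have ha j : j != k -> 0 <= a ord0 j.
  move=> jk; have /EsetP[/innerP/(_ j)] := kE.
  by rewrite !rowE (negbTE jk) /=; lia.
have ki : k != i.
  have := neg_ev_not_root I_monomial charK0 I_cofinite (k := i).
  apply: contra_notN => /eqP ki; rewrite ki in ak ha; rewrite (_ : - ev i = a) //.
  apply: row_ext => j; rewrite rowNE evE.
  have [->|ji] := eqVneq j i; first by rewrite ak.
  have := coord_sum j ab; rewrite (negbTE ji) /=; move: (ha _ ji).
  by move/innerP: hb => /(_ j); lia.
have bk : b ord0 k = 1 by have := coord_sum k ab; rewrite (negbTE ki) /= ak; lia.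
have iEb : i \in Eset I b.
  apply: Nspace_inner Nq _ => //; apply: contraNneq r0 => qi.
  have [x ->] := Nspace_outer ak kE Np.
  by rewrite !mxE qi [i == k]eq_sym (negbTE ki) /= !mulr0 subrr.
exists k; split=> //.
  have -> : ev i *+ 2 - ev k = a + (ev i *+ 2 - ev k - a) by rewrite [RHS]addrC subrK.
  apply: (outer_root_addr I_monomial charK0 ak) => //.
  - rewrite -ab addrAC [a + b]addrC addrK; apply/innerP => j; rewrite !rowE.
    move/innerP: hb => /(_ j); case: eqP => [->|_] /=; last lia.
    by rewrite bk.
  - by rewrite -ab addrAC [a + b]addrC addrK !rowE bk eqxx.
  - by rewrite [a + _]addrC !subrK.
have [_] := EsetP _ _ _ iEb; apply: contraNN => ik.
have -> : b + ev i = (ev i + ev k) + (b - ev k) 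
  by rewrite addrACA subrr addr0 addrC.
apply: supp_addr => //; apply/innerP => j; rewrite !rowE.
move/innerP: hb => /(_ j); case: eqP => [->|_] /=; last lia.
by rewrite bk.
Qed.

(** The linear forms are multiples of e_k^* and e_l^* for the negative
    coordinates k of a and l of b, so r_i <> 0 requires k = i or l = i; up to
    exchanging a and b it is l = i. *)
Lemma bracket_outer_outer a b p q i : is_root I a -> is_root I b ->
  ~~ inner a -> ~~ inner b -> a + b = ev i *+ 2 ->
  Nspace I a p -> Nspace I b q ->
  (pairing p b *: q - pairing q a *: p) ord0 i != 0 -> outer_splitting i.
Proof.
have main c d k : is_root I c -> is_root I d -> c + d = ev i *+ 2 ->
    c ord0 k = -1 -> d ord0 i = -1 -> k \in Eset I c -> i \in Eset I d ->
    outer_splitting i.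
  move=> rc rd cd ck di /EsetP[/innerP hc _] /EsetP[/innerP hd _].
  have ki : k != i.
    by apply: contraPneq ck => ->; have := coord_sum i cd; rewrite eqxx /=; lia.
  have off j : j != i -> j != k -> c ord0 j = 0 /\ d ord0 j = 0.
    move=> /negbTE ji /negbTE jk; have := coord_sum j cd; rewrite ji /=.
    by move: (hc j) (hd j); rewrite !rowE ji jk /=; lia.
  have dk : d ord0 k = 1 by have := coord_sum k cd; rewrite (negbTE ki) /=; lia.
  have dE : d = ev k - ev i.
    apply: row_ext => j; rewrite !rowE; have [->|ji] := eqVneq j i.
      by rewrite eq_sym (negbTE ki) di.
    by have [->|jk] := eqVneq j k; [rewrite dk | have [_ ->] := off _ ji jk].
  exists k; split; rewrite -?dE //.
  by rewrite (_ : _ - _ = c) // -[c](addrK d) cd dE mulrSr opprB addrA.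
move=> ra rb oa ob ab Np Nq r0.
have [k [ak kE]] := outer_root I_monomial ra oa.
have [l [bl lE]] := outer_root I_monomial rb ob.
have [li|li] := eqVneq l i.
  by rewrite li in bl lE; exact: main ra rb ab ak bl kE lE.
have [ki|ki] := eqVneq k i.
  by rewrite ki in ak kE; apply: main rb ra _ bl ak lE kE; rewrite addrC.
have [x pE] := Nspace_outer ak kE Np; have [y qE] := Nspace_outer bl lE Nq.
case/eqP: r0; rewrite pE qE !mxE [i == k]eq_sym [i == l]eq_sym.
by rewrite (negbTE ki) (negbTE li) !mulr0 subrr.
Qed.

Lemma bracket_splitting a b p q i : ev i *+ 2 \notin supp I ->
  is_root I a -> is_root I b -> a + b = ev i *+ 2 ->
  Nspace I a p -> Nspace I b q ->
  (pairing p b *: q - pairing q a *: p) ord0 i != 0 ->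
  mixed_splitting i \/ outer_splitting i.
Proof.
move=> i2 ra rb ab Np Nq r0.
have [ha|oa] := boolP (inner a); have [hb|ob] := boolP (inner b).
- by case/eqP: r0; exact: bracket_inner_inner ra.1 rb.1 ha hb ab.
- left; apply: (@bracket_outer_inner b a q p i) => //; first by rewrite addrC.
  by rewrite bracket_coordN oppr_eq0.
- by left; exact: bracket_outer_inner oa hb ab Np Nq r0.
- by right; exact: bracket_outer_outer oa ob ab Np Nq r0.
Qed.

(** * The hyperplane of 2e_i *)

Definition offdiag_span i : set ({ideal_quot I} -> {ideal_quot I}) :=
  lspan [set D | exists j : 'I_n, [/\ j \in Eset I (ev i *+ 2), j != i
    & D = dbar I (ev i *+ 2) (ev_dual j)]].

Lemma ev_muln_neq0 i r : ev i *+ r.+1 <> 0.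
Proof. by move=> /rowP/(_ i); rewrite mulmxnE evE eqxx row0E; lia. Qed.

Lemma offdiag_mem i p : p ord0 i = 0 -> offdiag_span i (dbar I (ev i *+ 2) p).
Proof.
move=> pi; apply: (dbar_mem I_monomial).
- exact: lspan_subspace.
- exact: inner_ev_muln.
move=> j pj jE; apply: lspan_subset; exists j; split=> //.
by apply: contraNneq pj => ->; rewrite pi.
Qed.

Lemma Bspace_sub_offdiag i : ev i *+ 2 \notin supp I ->
  ~ mixed_splitting i -> ~ outer_splitting i ->
  Bspace I (ev i *+ 2) `<=` offdiag_span i.
Proof.
move=> i2 Nm No; apply: (Bspace_least I_monomial charK0); first exact: lspan_subspace.
move=> a b p q ra rb ab Np Nq; apply: offdiag_mem; apply/eqP/contraT => r0.
by have [] := bracket_splitting i2 ra rb ab Np Nq r0.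
Qed.

(** The bracket of the derivations of degree e_i given by e_i^* and e_j^* is the
    one of degree 2e_i given by e_j^*. *)
Lemma offdiag_sub_Bspace i : ev i *+ 2 \notin supp I ->
  offdiag_span i `<=` Bspace I (ev i *+ 2).
Proof.
move=> i2; apply: lspan_least; first exact: lspan_subspace.
move=> _ [j [jE ji ->]].
have iE1 : i \in Eset I (ev i) by apply/EsetP; rewrite -mulr2n inner_ev_muln.
have jE1 : j \in Eset I (ev i).
  have [_] := EsetP _ _ _ jE => ij2; apply/EsetP; rewrite inner_addr ?inner_ev //.
  split=> //; apply: contraNN ij2 => ij1.
  by rewrite mulrS -addrA addrC supp_addr ?inner_ev.
have ri : is_root I (ev i).
  exact: (is_root_inner I_monomial (@ev_muln_neq0 i 0) (inner_ev i) iE1).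
have := Bspace_bracket I_monomial charK0 ri ri
  (Nspace_dual_inner (inner_ev i) iE1) (Nspace_dual_inner (inner_ev i) jE1).
rewrite !pairing_ev !ev_dualE eqxx eq_sym (negbTE ji) /= scale1r scale0r subr0.
by rewrite -mulr2n.
Qed.

(** Evaluation at x_i separates e_i^* from the other directions. *)
Lemma offdiag_coord i (D : {ideal_quot I} -> {ideal_quot I}) :
  offdiag_span i D -> D (qmon I (ev i)) = 0.
Proof.
have sW : subspace [set D : {ideal_quot I} -> {ideal_quot I} | D (qmon I (ev i)) = 0].
  split=> // c D1 D2 /= D1i D2i.
  change (c *: D1 (qmon I (ev i)) + D2 (qmon I (ev i)) = 0).
  by rewrite D1i D2i scaler0 addr0.
move: D; apply: lspan_least sW _ => _ [j [jE ji ->]] /=.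
rewrite (dbar_dual_qmon I_monomial); last exact/admissible_inner/inner_ev_muln.
by rewrite eq_sym (negbTE ji) scale0r.
Qed.

Lemma Bspace_full i : ev i *+ 2 \notin supp I ->
  (i \in Eset I (ev i *+ 2) ->
     Bspace I (ev i *+ 2) (dbar I (ev i *+ 2) (ev_dual i))) ->
  Bspace I (ev i *+ 2) = root_space I (ev i *+ 2).
Proof.
move=> i2 Bi; apply/seteqP; split.
  by apply: (Bspace_sub_root_space I_monomial charK0); exact: inner_ev_muln.
move=> _ [p _ <-]; apply: (dbar_mem I_monomial).
- exact: lspan_subspace.
- exact: inner_ev_muln.
move=> j _ jE; have [ji|ji] := eqVneq j i; first by move: jE; rewrite ji => /Bi.
apply: offdiag_sub_Bspace => //; apply: offdiag_mem.
by rewrite ev_dualE eq_sym (negbTE ji).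
Qed.

(** Modulo the span of the other directions e_i^* - c e_k^* is e_i^*. *)
Lemma Bspace_diag i k (c : K) : ev i *+ 2 \notin supp I -> k != i ->
  Bspace I (ev i *+ 2) (dbar I (ev i *+ 2) (ev_dual i - c *: ev_dual k)) ->
  Bspace I (ev i *+ 2) (dbar I (ev i *+ 2) (ev_dual i)).
Proof.
move=> i2 ki Bik; rewrite -(subrK (c *: ev_dual k) (ev_dual i)) addrC dbar_linearl.
apply: (lspan_subspace _).2 => //; apply: offdiag_sub_Bspace => //.
by apply: offdiag_mem; rewrite ev_dualE eq_sym (negbTE ki).
Qed.

(** The bracket is given by e_i^* - 2 e_k^*. *)
Lemma mixed_splitting_diag i : ev i *+ 2 \notin supp I -> mixed_splitting i ->
  Bspace I (ev i *+ 2) (dbar I (ev i *+ 2) (ev_dual i)).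
Proof.
move=> i2 [k [ki rk ik]].
have iE : i \in Eset I (ev k) by apply/EsetP; rewrite addrC inner_addr ?inner_ev.
have rek : is_root I (ev k).
  exact: (is_root_inner I_monomial (@ev_muln_neq0 k 0) (inner_ev k) iE).
have ak : (ev i *+ 2 - ev k) ord0 k = -1.
  by rewrite mulr2n !rowE eqxx (negbTE ki).
have := Bspace_bracket I_monomial charK0 rk rek (Nspace_dual_outer I ak)
  (Nspace_dual_inner (inner_ev k) iE).
rewrite subrK pairing_ev ev_dualE eqxx scale1r; exact: Bspace_diag.
Qed.

(** The bracket is given by e_i^* - 3 e_k^*. *)
Lemma outer_splitting_diag i : ev i *+ 2 \notin supp I -> outer_splitting i ->
  Bspace I (ev i *+ 2) (dbar I (ev i *+ 2) (ev_dual i)).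
Proof.
move=> i2 [k [ki rk r3]].
have ak : (ev i *+ 3 - ev k) ord0 k = -1.
  by rewrite !mulrS mulr0n !rowE eqxx (negbTE ki).
have bi : (ev k - ev i) ord0 i = -1.
  by rewrite !rowE eqxx eq_sym (negbTE ki).
have := Bspace_bracket I_monomial charK0 r3 rk (Nspace_dual_outer I ak)
  (Nspace_dual_outer I bi).
have -> : ev i *+ 3 - ev k + (ev k - ev i) = ev i *+ 2.
  by rewrite addrA subrK mulrSr addrK.
rewrite [pairing (ev_dual k) _]pairing_dual !rowE eqxx (negbTE ki) /= subr0 scale1r.
exact: Bspace_diag.
Qed.

End TwiceBasisVector.

Arguments offdiag_span {K n} I i _.

(** * Reducibility of 2e_i *)

Theorem lemma4p5 (K : closedFieldType) (charK0 : [pchar K] =i pred0)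
    (n : nat) (n_gt0 : (0 < n)%N) (I : idealr {mpoly K[n]})
    (I_monomial : monomial_ideal I) (I_cofinite : cofinite_support I)
    (xj_notin_I : forall j : 'I_n, ('X_j : {mpoly K[n]}) \notin I)
    (i : 'I_n) (root_2ei : is_root I (ev i *+ 2)) :
  (reducible I (ev i *+ 2) <->
    [\/ ev i *+ 3 \in supp I,
        exists k : 'I_n, [/\ k != i, is_root I (ev i *+ 2 - ev k)
                           & ev i + ev k \notin supp I]
      | exists k : 'I_n, [/\ k != i, is_root I (ev k - ev i)
                           & is_root I (ev i *+ 3 - ev k)]])
  /\
  (irreducible I (ev i *+ 2) ->
    [/\ i \in Eset I (ev i *+ 2),
        Bspace I (ev i *+ 2) =
          lspan [set D | exists j : 'I_n,
            [/\ j \in Eset I (ev i *+ 2), j != i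
              & D = dbar I (ev i *+ 2) (ev_dual j)]],
        hyperplane (root_space I (ev i *+ 2)) (Bspace I (ev i *+ 2))
      & mu I (ev i *+ 2) = 1%N]).
Proof.
have hg := inner_ev_muln i 2.
have sR := root_space_subspace I hg.
have sB : subspace (Bspace I (ev i *+ 2)) := lspan_subspace _.
have i2 : ev i *+ 2 \notin supp I.
  have [_ _ [k /EsetP[_ kE] _]] := root_pairing I_monomial root_2ei.
  by apply: contraNN kE => i2; rewrite supp_addr ?inner_ev.
have iE3 : i \in Eset I (ev i *+ 2) <-> ev i *+ 3 \notin supp I.
  rewrite (mulrSr _ 2); split=> [/EsetP[]//|i3].
  by apply/EsetP; rewrite inner_addr ?inner_ev.
have redI : [\/ ev i *+ 3 \in supp I, mixed_splitting I i | outer_splitting I i] ->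
    reducible I (ev i *+ 2).
  move=> c; apply: (Bspace_full I_monomial charK0) => // iE.
  case: c => [i3|mx|ou].
  - by have := iE3.1 iE; rewrite i3.
  - exact: mixed_splitting_diag.
  - exact: outer_splitting_diag.
have irredE : ~ [\/ ev i *+ 3 \in supp I, mixed_splitting I i | outer_splitting I i] ->
    i \in Eset I (ev i *+ 2) /\ Bspace I (ev i *+ 2) = offdiag_span I i.
  move=> Nc; split.
    by apply/iE3/negP => i3; apply: Nc; constructor 1.
  apply/seteqP; split; last exact: offdiag_sub_Bspace.
  by apply: Bspace_sub_offdiag => // ?; apply: Nc; [constructor 2|constructor 3].
have diagP (c : K) : i \in Eset I (ev i *+ 2) ->
    offdiag_span I i (c *: dbar I (ev i *+ 2) (ev_dual i)) -> c = 0.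
  move=> iE /(offdiag_coord I_monomial) /=.
  have -> : (c *: dbar I (ev i *+ 2) (ev_dual i)) (qmon I (ev i)) =
    c *: dbar I (ev i *+ 2) (ev_dual i) (qmon I (ev i)) by [].
  rewrite (dbar_dual_qmon I_monomial); last exact: admissible_inner.
  rewrite eqxx scale1r => /eqP; rewrite scaler_eq0 => /orP[/eqP//|/eqP].
  by move=> q0; case: (qmon_Eset_neq0 iE).
have redP : reducible I (ev i *+ 2) ->
    [\/ ev i *+ 3 \in supp I, mixed_splitting I i | outer_splitting I i].
  move=> rd; apply: contrapT => /irredE[iE BE].
  have : offdiag_span I i (1 *: dbar I (ev i *+ 2) (ev_dual i)).
    by rewrite scale1r -BE rd; apply: dbar_root_space.
  by move/(diagP _ iE)/eqP; rewrite oner_eq0.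
split; first by split.
move=> ir; have [iE BE] := irredE (fun c => ir (redI c)).
have dim1 : is_dim_quot (root_space I (ev i *+ 2)) (Bspace I (ev i *+ 2)) 1.
  exists (fun=> dbar I (ev i *+ 2) (ev_dual i)); split.
    by move=> _; exact: dbar_root_space.
  move=> _ [p _ <-]; rewrite BE.
  have mem : offdiag_span I i (dbar I (ev i *+ 2) p -
      p ord0 i *: dbar I (ev i *+ 2) (ev_dual i)).
    rewrite -scaleNr addrC -dbar_linearl; apply: offdiag_mem => //.
    by rewrite !mxE !eqxx mulr1 addNr.
  exists (const_mx (p ord0 i)); split; first by rewrite big_ord1 mxE.
  move=> c; rewrite big_ord1 => memc.
  suff pc : p ord0 i - c ord0 ord0 = 0.
    by apply/rowP => j; rewrite mxE (ord1 j); exact/subr0_eq.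
  apply: (diagP _ iE); have := (lspan_subspace _).2 (-1) _ _ mem memc.
  by rewrite scaleN1r opprB addrA subrK -scalerBl.
split=> //.
  by split=> //; exact: Bspace_sub_root_space.
exact: (dim_quotE sR sB dim1).
Qed.
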